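(* Let $\mathcal F=\{f_\lambda\}_{\lambda\in\Lambda}\subseteq l^\infty(\mathbb N)$ for an index set $\Lambda$, let $\mathcal A_0$ be the unital C*-algebra generated by $\mathcal F$, and let $\mathcal A_{\mathcal F}$ be the smallest $\sigma_A$-invariant C*-subalgebra of $l^\infty(\mathbb N)$ containing $\mathcal A_0$, with maximal ideal space $X_{\mathcal F}$. Then: (i) For $n\in\mathbb N$ put $z_n=(f_\lambda(n))_{\lambda\in\Lambda}\in\prod_{\lambda}\overline{f_\lambda(\mathbb N)}$ and let $X_0$ be the closure of $\{z_n:n\in\mathbb N\}$ in this product. Then $\mathcal A_0\cong C(X_0)$, via $g\mapsto (n\mapsto g(z_n))$. (ii) Put $\kappa_n=(z_n,z_{n+1},\ldots)\in X_0^{\mathbb N}$ and let $Y_{\mathcal F}$ be the closure of $\{\kappa_n:n\in\mathbb N\}$ in $X_0^{\mathbb N}$. Then $\mathcal A_{\mathcal F}\cong C(Y_{\mathcal F})$, via $h\mapsto(n\mapsto h(\kappa_n))$. (iii) Let $B$ be the shift $(\omega_0,\omega_1,\ldots)\mapsto(\omega_1,\omega_2,\ldots)$ on $X_0^{\mathbb N}$ and $B_{\mathcal F}=B|_{Y_{\mathcal F}}$. Then there is a homeomorphism $X_{\mathcal F}\to Y_{\mathcal F}$ sending $\iota(n)$ to $\kappa_n$ for all $n$ and conjugating the map $A$ on $X_{\mathcal F}$ to $B_{\mathcal F}$. In particular $\mathrm{AE}(\mathcal F)=h(B_{\mathcal F})$.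
   Context: $\mathbb N=\{0,1,2,\ldots\}$, $l^\infty(\mathbb N)$ the bounded complex functions on $\mathbb N$, $(\sigma_Af)(n)=f(n+1)$; $\overline{f(\mathbb N)}$ is the closure of $f(\mathbb N)$ in $\mathbb C$; products carry the product topology. For an anqie (unital $\sigma_A$-invariant C*-subalgebra) $\mathcal A$ with maximal ideal space $X$, $\iota(n)\in X$ is evaluation at $n$ and $A:X\to X$, $(A\rho)(f)=\rho(\sigma_Af)$, is the continuous map with $A\iota(n)=\iota(n+1)$; $\mathrm{AE}(\mathcal F)=h(A)$ for $\mathcal A=\mathcal A_{\mathcal F}$, where $h$ is topological entropy. *)

(* Defs.v *)
From HB Require Import structures.
From mathcomp Require Import all_boot all_order all_algebra.
From mathcomp Require Import all_classical all_reals all_analysis.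
From mathcomp.real_closed Require Import complex.
Set Implicit Arguments. Unset Strict Implicit. Unset Printing Implicit Defensive.
Import Order.TTheory GRing.Theory Num.Theory.
Import numFieldTopology.Exports numFieldNormedType.Exports.
Local Open Scope classical_set_scope.
Local Open Scope ring_scope.
Local Open Scope complex_scope.

(* the complex numbers R[i] get the standard (norm) topology *)
HB.instance Definition _ (R : realType) := PseudoPointedMetric.copy R[i] (R[i])^o.

Section Defs.
Variable R : realType.
Local Notation C := (R[i]).

(* l^infty(N) ambient: complex sequences; boundedness as a predicate *)
Definition bounded_seq (f : nat -> C) : Prop := exists M : R, forall n, `|f n| <= M%:C.

Definition sigmaA (f : nat -> C) : nat -> C := fun n => f n.+1.

Definition is_cstar_subalg (S : set (nat -> C)) : Prop :=
  S `<=` bounded_seq /\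
  S (fun _ => 1) /\
  (forall f g, S f -> S g -> S (fun n => f n + g n)) /\
  (forall f g, S f -> S g -> S (fun n => f n * g n)) /\
  (forall (a : C) f, S f -> S (fun n => a * f n)) /\
  (forall f, S f -> S (fun n => Num.conj (f n))) /\
      (forall (u : nat -> nat -> C) (f : nat -> C),
         (forall k, S (u k)) ->
         (forall e : R, 0 < e -> exists k0, forall k, (k0 <= k)%N ->
              forall n, `|u k n - f n| <= e%:C) ->
         S f).

Definition sigma_invariant (S : set (nat -> C)) : Prop :=
  forall f, S f -> S (sigmaA f).

Variable Lambda : Type.
Variable F : Lambda -> nat -> C.

Definition A0 : set (nat -> C) :=
  [set f | forall S, is_cstar_subalg S -> (forall l, S (F l)) -> S f].

Definition AF : set (nat -> C) :=
  [set f | forall S, is_cstar_subalg S -> sigma_invariant S -> A0 `<=` S -> S f].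

Definition zF (n : nat) : {ptws Lambda -> C} := fun l => F l n.
Definition X0 : set {ptws Lambda -> C} := closure (range zF).
Definition kappaF (n : nat) : {ptws nat -> {ptws Lambda -> C}} :=
  fun k => zF (n + k)%N.
Definition YF : set {ptws nat -> {ptws Lambda -> C}} := closure (range kappaF).
Definition Bshift (w : {ptws nat -> {ptws Lambda -> C}}) :
  {ptws nat -> {ptws Lambda -> C}} := fun k => w k.+1.

(* maximal ideal space of A_F = characters of A_F with the weak* topology;
   a character rho is represented by a function on all of (nat -> C) which
   vanishes off A_F, and the weak* topology is the pointwise topology *)
Definition XF : set {ptws (nat -> C) -> C} :=
  [set rho | [/\ (forall f, ~ AF f -> rho f = 0),
     rho (fun _ => 1) = 1,
     (forall f g, AF f -> AF g -> rho (fun n => f n + g n) = rho f + rho g),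
     (forall (a : C) f, AF f -> rho (fun n => a * f n) = a * rho f) &
     (forall f g, AF f -> AF g -> rho (fun n => f n * g n) = rho f * rho g)]].

Definition iotaF (n : nat) : {ptws (nat -> C) -> C} :=
  fun f => if `[< AF f >] then f n else 0.

Definition AmapF (rho : {ptws (nat -> C) -> C}) : {ptws (nat -> C) -> C} :=
  fun f => if `[< AF f >] then rho (sigmaA f) else 0.

End Defs.

Section Entropy.
Variable R : realType.
Variable T : topologicalType.

(* minimal number of members of the family V needed to cover K
   (0 if no finite subfamily covers K) *)
Definition Ncov (I : eqType) (K : set T) (V : I -> set T) : nat :=
  match pselect (exists n, exists s : seq I, size s = n /\
                   K `<=` \bigcup_(i in [set` s]) V i) with
  | left h => ex_minn (P := fun n => `[< exists s : seq I, size s = n /\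
                   K `<=` \bigcup_(i in [set` s]) V i >])
                 (let: ex_intro n hn := h in ex_intro _ n (asboolT hn))
  | right _ => 0%N
  end.

(* the join  U v Tm^-1 U v ... v Tm^-(n-1) U  (traced on K), indexed by words *)
Definition join_cover (K : set T) (Tm : T -> T) (m n : nat) (U : 'I_m -> set T)
   (w : {ffun 'I_n -> 'I_m}) : set T :=
  [set x | K x /\ forall j : 'I_n, U (w j) (iter j Tm x)].

Definition entropy_cover (K : set T) (Tm : T -> T) (m : nat) (U : 'I_m -> set T)
  : \bar R :=
  limn_esup (fun n => ((ln (Ncov K (join_cover K Tm U (n := n)))%:R : R) / n%:R)%:E).

(* topological entropy of Tm restricted to the compact invariant set K:
   supremum over finite open covers of K *)
Definition top_entropy (K : set T) (Tm : T -> T) : \bar R :=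
  ereal_sup [set entropy_cover K Tm (projT2 U) | U in
     [set U : {m : nat & 'I_m -> set T} | (forall i, open (projT2 U i)) /\
        K `<=` \bigcup_i projT2 U i]].

End Entropy.

Definition AE (R : realType) (Lambda : Type) (F : Lambda -> nat -> R[i]) : \bar R :=
  top_entropy R (XF F) (AmapF F).

(* Main.v *)
Require Import Defs.
From HB Require Import structures.
From mathcomp Require Import all_boot all_order all_algebra.
From mathcomp Require Import all_classical all_reals all_analysis.
From mathcomp.real_closed Require Import complex.
From mathcomp Require Import ring lra.
Set Implicit Arguments. Unset Strict Implicit. Unset Printing Implicit Defensive.
Import Order.TTheory GRing.Theory Num.Theory.
Import numFieldTopology.Exports numFieldNormedType.Exports.
Local Open Scope classical_set_scope.
Local Open Scope ring_scope.
Local Open Scope complex_scope.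

(* Both algebras consist of the sequences that are uniformly continuous for the
   initial uniformity on the natural numbers of a family of bounded sequences:
   the [F l] for [A0 F], the translates [n |-> F l (n + k)] for [AF F].
   These uniformly continuous sequences form a C*-algebra; conversely they lie
   in every C*-algebra containing the family, by a Stone-Weierstrass argument
   that only uses squared moduli, powers and geometric series.  By compactness
   and by extension of uniformly continuous functions to the closure of a
   dense sequence, they are also the continuous functions on that closure,
   which gives (i) and (ii).
   For (iii), a character [x] is sent to the point of coordinates
   [x (n |-> F l (n + k))]; it lies in [YF F] because evaluations are dense
   among characters, and the inverse map sends [y] to the evaluation at [y] of
   the continuous extensions.  Topological entropy is a conjugacy invariant. *)

(** The norm of [R[i]] takes its values in [R[i]]; a modulus with values in [R] lets all estimates
    be made in a real field. *)
Definition cmod (R : realType) (x : R[i]) : R := complex.Re `|x|.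

(** * The real-valued modulus on the complex numbers *)

Section Modulus.
Variable R : realType.
Implicit Types x y : R[i].

Lemma normr_cmod x : `|x| = (cmod x)%:C.
Proof. by rewrite /cmod RRe_real// normr_real. Qed.

Lemma normr_le_cmod x (e : R) : (`|x| <= e%:C) = (cmod x <= e).
Proof. by rewrite normr_cmod lecR. Qed.

Lemma cmod_ge0 x : 0 <= cmod x.
Proof. by rewrite -lecR -normr_cmod normr_ge0. Qed.

Lemma cmodD x y : cmod (x + y) <= cmod x + cmod y.
Proof. by rewrite -lecR rmorphD/= -!normr_cmod ler_normD. Qed.

Lemma cmodM x y : cmod (x * y) = cmod x * cmod y.
Proof. by apply: complexI; rewrite rmorphM/= -!normr_cmod normrM. Qed.

Lemma cmodN x : cmod (- x) = cmod x.
Proof. by rewrite /cmod normrN. Qed.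

Lemma cmod_distC x y : cmod (x - y) = cmod (y - x).
Proof. by rewrite /cmod distrC. Qed.

Lemma cmod_dist x y z : cmod (x - z) <= cmod (x - y) + cmod (y - z).
Proof. by apply: le_trans (cmodD _ _); rewrite addrA subrK. Qed.

Lemma cmod_real (r : R) : cmod r%:C = `|r|.
Proof. by apply: complexI; rewrite -normr_cmod normc_def/= expr0n addr0 sqrtr_sqr. Qed.

Lemma cmod0 : cmod (0 : R[i]) = 0.
Proof. by rewrite /cmod normr0. Qed.

Lemma cmod_eq0 x : (cmod x == 0) = (x == 0).
Proof. by rewrite -(inj_eq (@complexI R)) -normr_cmod normr_eq0. Qed.

Lemma cmodJ x : cmod (Num.conj x) = cmod x.
Proof. by rewrite /cmod norm_conjC. Qed.

Lemma mulr_conj x : x * Num.conj x = (cmod x ^+ 2)%:C.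
Proof. by rewrite -normCK normr_cmod rmorphXn. Qed.

Lemma cmod_sum (I : Type) (s : seq I) (f : I -> R[i]) :
  cmod (\sum_(i <- s) f i) <= \sum_(i <- s) cmod (f i).
Proof.
elim: s => [|i s ih]; first by rewrite !big_nil cmod0.
by rewrite !big_cons (le_trans (cmodD _ _))// lerD2l.
Qed.

Lemma cmod_Re x : `|complex.Re x| <= cmod x.
Proof. by rewrite -lecR -normr_cmod normc_ge_Re. Qed.

Lemma cmod_Im x : `|complex.Im x| <= cmod x.
Proof.
rewrite -[cmod x]ger0_norm ?cmod_ge0// -ler_sqr ?nnegrE ?normr_ge0//.
rewrite !real_normK ?num_real//.
have : (cmod x ^+ 2)%:C = (complex.Re x ^+ 2 + complex.Im x ^+ 2)%:C.
  by rewrite add_Re2_Im2 normr_cmod rmorphXn.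
by move=> /complexI ->; rewrite lerDr sqr_ge0.
Qed.

Lemma cmod_le_ReIm x : cmod x <= `|complex.Re x| + `|complex.Im x|.
Proof.
rewrite {1}(complexE x) (le_trans (cmodD _ _))// cmodM !cmod_real.
rewrite /cmod normc_def /= expr0n expr1n add0r sqrtr1 mul1r//.
Qed.

End Modulus.

(** * Closure properties of C*-subalgebras of bounded sequences *)

Section CstarSubalgebra.
Variables (R : realType) (S : set (nat -> R[i])).
Hypothesis hS : is_cstar_subalg S.

Lemma cstar_bounded f : S f -> exists2 M : R, 0 < M & forall n, cmod (f n) <= M.
Proof.
move=> /(proj1 hS)[M hM]; exists (Num.max M 1); first by rewrite lt_max ltr01 orbT.
by move=> n; rewrite le_max -normr_le_cmod hM.
Qed.

Lemma cstarD f g : S f -> S g -> S (fun n => f n + g n).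
Proof. by case: hS => _ [_ [h _]]; exact: h. Qed.

Lemma cstarM f g : S f -> S g -> S (fun n => f n * g n).
Proof. by case: hS => _ [_ [_ [h _]]]; exact: h. Qed.

Lemma cstarZ a f : S f -> S (fun n => a * f n).
Proof. by case: hS => _ [_ [_ [_ [h _]]]]; exact: h. Qed.

Lemma cstarJ f : S f -> S (fun n => Num.conj (f n)).
Proof. by case: hS => _ [_ [_ [_ [_ [h _]]]]]; exact: h. Qed.

Lemma cstar_cst a : S (fun=> a).
Proof.
have := @cstarZ a (fun=> 1) (proj1 (proj2 hS)).
by congr S; apply/funext => n; rewrite mulr1.
Qed.

Lemma cstarB f g : S f -> S g -> S (fun n => f n - g n).
Proof.
move=> Sf Sg; have := cstarD Sf (cstarZ (-1) Sg).
by congr S; apply/funext => n; rewrite mulN1r.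
Qed.

Lemma cstarX f k : S f -> S (fun n => f n ^+ k).
Proof.
move=> Sf; elim: k => [|k ih]; first exact: cstar_cst.
have := cstarM Sf ih.
by congr S; apply/funext => n; rewrite exprS.
Qed.

Lemma cstar_sum (I : Type) (s : seq I) (f : I -> nat -> R[i]) :
  (forall i, S (f i)) -> S (fun n => \sum_(i <- s) f i n).
Proof.
move=> Sf; elim: s => [|i s ih].
  by have := cstar_cst 0; congr S; apply/funext => n; rewrite big_nil.
by have := cstarD (Sf i) ih; congr S; apply/funext => n; rewrite big_cons.
Qed.

Lemma cstar_cmod2 f : S f -> S (fun n => (cmod (f n) ^+ 2)%:C).
Proof.
move=> Sf; have := cstarM Sf (cstarJ Sf).
by congr S; apply/funext => n; rewrite mulr_conj.
Qed.

Lemma cstar_closed f :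
  (forall e : R, 0 < e -> exists2 g, S g & forall n, cmod (g n - f n) <= e) -> S f.
Proof.
move=> h; have hu k : {g | S g /\ forall n, cmod (g n - f n) <= k.+1%:R^-1}.
  by apply: cid; have [|g] := h k.+1%:R^-1; [rewrite invr_gt0|exists g].
case: hS => _ [_ [_ [_ [_ [_ hc]]]]].
apply: (hc (fun k => projT1 (hu k))) => [k|e e0]; first by case: (hu k) => g [].
(* For [k] at least the integer part of [1 / e], [k + 1] exceeds [1 / e]. *)
exists (Num.trunc e^-1) => k hk n; rewrite normr_le_cmod.
case: (hu k) => g [_ /= /(_ n) hg]; apply: le_trans hg _.
rewrite -[leRHS]invrK lef_pV2 ?posrE ?invr_gt0//.
apply: le_trans (ltW (truncnS_gt _)) _.
by rewrite ler_nat ltnS.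
Qed.

End CstarSubalgebra.

Lemma exists_expr_small (R : realType) (q K e : R) :
  0 <= q < 1 -> 0 < e -> exists N, K * q ^+ N <= e.
Proof.
move=> /andP[q0 q1] e0.
have : (fun n => K * q ^+ n) @ \oo --> K * (0 : R).
  by apply: cvgMr; apply: cvg_expr; rewrite ger0_norm.
rewrite mulr0 => /cvgrPdist_le/(_ e e0)[N _ /(_ N (leqnn _))].
rewrite sub0r normrN => h; exists N; exact: le_trans (ler_norm _) h.
Qed.

(** Geometric series: with [r = 1 - a / M], which lies between [0] and [1 - d / M < 1], the inverse
    of [a] is the uniform limit of [M^-1] times the partial sums of the powers of [r]. *)
Lemma cstar_inv (R : realType) (S : set (nat -> R[i])) (a : nat -> R) (d : R) :
  is_cstar_subalg S -> S (fun n => (a n)%:C) -> 0 < d -> (forall n, d <= a n) ->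
  S (fun n => (a n)^-1%:C).
Proof.
move=> hS Sa d0 da; have [M M0 aM] := cstar_bounded hS Sa.
have {}aM n : a n <= M.
  by have := aM n; rewrite cmod_real; apply: le_trans; rewrite ler_norm.
pose r n := 1 - a n / M.
have dM : d <= M by apply: le_trans (da 0%N) (aM 0%N).
have r0 n : 0 <= r n by rewrite subr_ge0 ler_pdivrMr// mul1r.
have rq n : r n <= 1 - d / M.
  by rewrite lerD2l lerN2 ler_pM2r ?invr_gt0.
have q1 : 0 <= 1 - d / M < 1.
  by rewrite (le_trans (r0 0%N))//= gtrBl divr_gt0.
apply: (cstar_closed hS) => e e0.
(* The remainder of the series after [N] terms is [r ^+ N / a], at most
   [d^-1 * (1 - d / M) ^+ N]. *)
have [N hN] := @exists_expr_small _ _ d^-1 e q1 e0.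
exists (fun n => (M^-1 * \sum_(j < N) r n ^+ j)%:C).
  have Sr : S (fun n => (r n)%:C).
    have := cstarB hS (cstar_cst hS 1) (cstarZ hS (M^-1)%:C Sa).
    by congr S; apply/funext => n; rewrite /r rmorphB rmorphM /= mulrC.
  have := cstarZ hS (M^-1)%:C (cstar_sum hS (index_enum 'I_N)
    (fun j : 'I_N => cstarX hS j Sr)).
  congr S; apply/funext => n; rewrite rmorphM/=; congr (_ * _).
  by rewrite rmorph_sum; apply: eq_bigr => j _; rewrite rmorphXn.
move=> n; rewrite -rmorphB cmod_real.
have an0 : 0 < a n by exact: lt_le_trans (da n).
have -> : M^-1 * (\sum_(j < N) r n ^+ j) - (a n)^-1 = - (r n ^+ N / a n).
  have h : (a n / M) * (\sum_(j < N) r n ^+ j) = 1 - r n ^+ N.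
    rewrite -opprB subrX1 -mulNr; congr (_ * _).
    by rewrite /r; ring.
  apply: (mulfI (lt0r_neq0 an0)); rewrite mulrBr mulrA h mulrN divff ?gt_eqF//.
  by rewrite mulrCA divff ?gt_eqF// mulr1; ring.
rewrite normrN ger0_norm ?divr_ge0 ?exprn_ge0 ?(ltW an0)//.
apply: le_trans hN; rewrite mulrC ler_pM ?invr_ge0 ?exprn_ge0 ?(ltW an0)//.
  by rewrite lef_pV2.
by rewrite lerXn2r ?nnegrE//; case/andP: q1.
Qed.

(** * Basic entourages of an initial uniformity *)

Section Proximity.
Variables (R : realType) (T I : Type) (p : I -> T -> R[i]).

(** For [d > 0] these are the basic entourages of the uniformity pulled back along the maps [p i]:
    finitely many coordinates and one radius. *)
Definition near_at (s : seq I) (d : R) (x y : T) : bool :=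
  all (fun i => cmod (p i x - p i y) < d) s.

Lemma near_at_refl s d x : 0 < d -> near_at s d x x.
Proof. by move=> d0; elim: s => //= i s ->; rewrite subrr cmod0 d0. Qed.

Lemma near_at_sym s d x y : near_at s d x y = near_at s d y x.
Proof. by apply: eq_all => i; rewrite cmod_distC. Qed.

Lemma near_at_cat s1 s2 d1 d2 x y :
  near_at (s1 ++ s2) (Num.min d1 d2) x y -> near_at s1 d1 x y /\ near_at s2 d2 x y.
Proof.
rewrite /near_at all_cat => /andP[h1 h2].
by split; [move: h1|move: h2]; apply: sub_all => i; rewrite lt_min => /andP[].
Qed.

Lemma near_at_half s d x y z :
  near_at s (d / 2) x y -> near_at s (d / 2) y z -> near_at s d x z.
Proof.
elim: s => //= i s ih /andP[h1 /ih h2] /andP[h3 /h2 ->]; rewrite andbT.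
have := cmod_dist (p i x) (p i y) (p i z); lra.
Qed.

Lemma near_at_lt s d d' x y :
  d <= d' -> near_at s d x y -> near_at s d' x y.
Proof. by move=> dd'; apply: sub_all => i /lt_le_trans; apply. Qed.

End Proximity.

(** * Uniformly continuous sequences and the Stone-Weierstrass argument *)

Section UniformContinuity.
Variables (R : realType) (I : Type) (F : I -> nat -> R[i]).

Definition ucont (f : nat -> R[i]) : Prop :=
  forall e : R, 0 < e -> exists s d, 0 < d /\
    forall n m, near_at F s d n m -> cmod (f n - f m) < e.

Lemma ucont_gen i : ucont (F i).
Proof. by move=> e e0; exists [:: i], e; split => // n m; rewrite /near_at/= andbT. Qed.

Lemma ucont2 f g e : 0 < e -> ucont f -> ucont g -> exists s d, 0 < d /\
    forall n m, near_at F s d n m -> cmod (f n - f m) < e /\ cmod (g n - g m) < e.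
Proof.
move=> e0 /(_ e e0)[s1 [d1 [d10 h1]]] /(_ e e0)[s2 [d2 [d20 h2]]].
exists (s1 ++ s2), (Num.min d1 d2); split; first by rewrite lt_min d10.
by move=> n m nm; have [/h1 ? /h2 ?] := near_at_cat nm.
Qed.

Hypothesis hF : forall i, bounded_seq (F i).

(** Total boundedness: the real and imaginary parts range over bounded intervals, which are cut into
    finitely many cells of width [d / 2]; the colour of [n] is its pair of cells. Colourings, unlike
    nets, combine at once over several sequences. *)
Lemma bounded_coloring (f : nat -> R[i]) (d : R) : bounded_seq f -> 0 < d ->
  exists (T : finType) (c : nat -> T),
    forall n m, c n = c m -> cmod (f n - f m) < d.
Proof.
move=> [M hM] d0.
have M0 : 0 <= M by have := hM 0%N; rewrite normr_le_cmod; apply/le_trans/cmod_ge0.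
have real_coloring (x : nat -> R) : (forall n, `|x n| <= M) ->
    exists (T : finType) (c : nat -> T), forall n m, c n = c m -> `|x n - x m| < d / 2.
  (* The rescaling turns cells of width [d / 2] into unit intervals, so the integer part of [y n]
     numbers the cell of [x n]. *)
  move=> xM; pose y n := (x n + M) / (d / 2).
  have y0 n : 0 <= y n.
    by rewrite divr_ge0 ?(ltW d0)//; have := xM n; rewrite ler_norml => /andP[]; lra.
  have yM n : y n <= (2 * M) / (d / 2).
    by rewrite ler_pM2r ?invr_gt0 ?divr_gt0//; have := xM n; rewrite ler_norml => /andP[]; lra.
  exists 'I_(Num.trunc ((2 * M) / (d / 2))).+1, (fun n => inord (Num.trunc (y n))).
  move=> n m /(congr1 val); rewrite /= !inordK ?ltnS ?le_truncn// => h.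
  have hn := truncn_itv (y0 n); have hm := truncn_itv (y0 m).
  have : `|y n - y m| < 1.
    move: hn hm; rewrite h => /andP[h1 h2] /andP[h3 h4].
    rewrite -natr1 in h2 h4; rewrite ltr_norml; lra.
  have -> : y n - y m = (x n - x m) / (d / 2) by rewrite /y; ring.
  by rewrite normrM normfV [`|d / 2|]gtr0_norm ?divr_gt0// ltr_pdivrMr ?divr_gt0// mul1r.
have [|T1 [c1 h1]] := real_coloring (fun n => complex.Re (f n)).
  by move=> n; apply: le_trans (cmod_Re _) _; rewrite -normr_le_cmod.
have [|T2 [c2 h2]] := real_coloring (fun n => complex.Im (f n)).
  by move=> n; apply: le_trans (cmod_Im _) _; rewrite -normr_le_cmod.
exists (T1 * T2)%type, (fun n => (c1 n, c2 n)) => n m [/h1 e1 /h2 e2].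
apply: le_lt_trans (cmod_le_ReIm _) _; rewrite !raddfB/=; lra.
Qed.

Lemma near_at_net s d : 0 < d ->
  exists t : seq nat, forall n, exists2 m, m \in t & near_at F s d n m.
Proof.
move=> d0.
have [T [c hc]] : exists (T : finType) (c : nat -> T),
    forall n m, c n = c m -> near_at F s d n m.
  elim: s => [|i s [T [c hc]]]; first by exists unit, (fun=> tt).
  have [T' [c' hc']] := bounded_coloring (hF i) d0.
  exists (T * T')%type, (fun n => (c n, c' n)) => n m [/hc h /hc' h'].
  by rewrite /near_at/= h'.
(* One representative per colour; a colour that is not attained contributes the harmless index
   [0]. *)
exists [seq xget 0%N [set n | c n = x] | x <- enum T] => n.
exists (xget 0%N [set k | c k = c n]); first by apply: map_f; rewrite mem_enum.
by apply/hc; case: xgetP => [k _ /= ->|h] //; case: (h n).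
Qed.

Lemma ucont_bounded f : ucont f -> bounded_seq f.
Proof.
move=> /(_ 1 ltr01)[s [d [d0 h]]]; have [t ht] := near_at_net s d0.
exists (1 + \sum_(m <- t) cmod (f m)) => n; rewrite normr_le_cmod.
have [m mt /h nm] := ht n.
have : cmod (f m) <= \sum_(m <- t) cmod (f m).
  by rewrite (big_rem m mt)/= lerDl sumr_ge0// => k _; rewrite cmod_ge0.
have := cmodD (f n - f m) (f m); rewrite subrK; lra.
Qed.

Lemma ucont_cstar_subalg : is_cstar_subalg ucont.
Proof.
split; first exact: ucont_bounded.
split; first by move=> e e0; exists [::], 1; split => // n m _; rewrite subrr cmod0.
split.
  move=> f g uf ug e e0; have e20 : 0 < e / 2 by rewrite divr_gt0.
  have [s [d [d0 h]]] := ucont2 e20 uf ug; exists s, d; split => // n m /h[h1 h2].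
  have := cmodD (f n - f m) (g n - g m); rewrite addrACA -opprD; lra.
split.
  move=> f g uf ug e e0.
  have [M hM] := ucont_bounded uf; have [M' hM'] := ucont_bounded ug.
  have M0 : 0 <= M by have := hM 0%N; rewrite normr_le_cmod; apply/le_trans/cmod_ge0.
  have M'0 : 0 <= M' by have := hM' 0%N; rewrite normr_le_cmod; apply/le_trans/cmod_ge0.
  (* The summand [1] makes [K] positive and the final bound [(M + M') * (e / K)] strictly less than
     [e]. *)
  pose K := M + M' + 1; have K0 : 0 < K by rewrite /K; lra.
  have eK : 0 < e / K by rewrite divr_gt0.
  have [s [d [d0 h]]] := ucont2 eK uf ug; exists s, d; split => // n m /h[h1 h2].
  have -> : f n * g n - f m * g m = f n * (g n - g m) + (f n - f m) * g m by ring.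
  apply: le_lt_trans (cmodD _ _) _; rewrite !cmodM.
  have b1 : cmod (f n) * cmod (g n - g m) <= M * (e / K).
    by apply: ler_pM; rewrite ?cmod_ge0 -?normr_le_cmod// normr_le_cmod ltW.
  have b2 : cmod (f n - f m) * cmod (g m) <= (e / K) * M'.
    by apply: ler_pM; rewrite ?cmod_ge0 -?normr_le_cmod// normr_le_cmod ltW.
  have : e = K * (e / K) by rewrite mulrCA divff ?mulr1// gt_eqF.
  rewrite {1}/K; nra.
split.
  move=> a f uf e e0; pose K := cmod a + 1.
  have K0 : 0 < K by rewrite /K; have := cmod_ge0 a; lra.
  have [s [d [d0 h]]] := uf (e / K) (divr_gt0 e0 K0); exists s, d; split => // n m /h h1.
  have -> : a * f n - a * f m = a * (f n - f m) by rewrite mulrBr.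
  rewrite cmodM.
  have : K * cmod (f n - f m) < e by rewrite mulrC -ltr_pdivlMr.
  rewrite /K; have := cmod_ge0 (f n - f m); nra.
split.
  move=> f uf e e0; have [s [d [d0 h]]] := uf e e0; exists s, d; split => // n m /h.
  by rewrite -rmorphB cmodJ.
move=> u f uu uf e e0; have e30 : 0 < e / 3 by rewrite divr_gt0.
have [k /(_ k (leqnn k)) hk] := uf _ e30.
have [s [d [d0 h]]] := uu k _ e30; exists s, d; split => // n m /h h1.
have := hk n; have := hk m; rewrite !normr_le_cmod => hm; rewrite cmod_distC => hn.
have := cmod_dist (f n) (u k n) (f m); have := cmod_dist (u k n) (u k m) (f m); lra.
Qed.

(* With [D n m] the sum of the squared distances [|F i n - F i m|^2] over the
   relevant [i], the weights [(1 - D n m / M) ^ N], for [m] in a finite net,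
   lie in the algebra; as [N] grows, the weighted average of the values [f m]
   is dominated by the [m] that are close to [n]. *)
Lemma ucont_sub_cstar (S : set (nat -> R[i])) : is_cstar_subalg S ->
  (forall i, S (F i)) -> ucont `<=` S.
Proof.
move=> hS SF f uf; apply: (cstar_closed hS) => e e0.
have e20 : 0 < e / 2 by rewrite divr_gt0.
have [s [d [d0 h]]] := uf _ e20.
have [Mf hMf] := ucont_bounded uf.
have Mf0 : 0 <= Mf by have := hMf 0%N; rewrite normr_le_cmod; apply/le_trans/cmod_ge0.
pose D n m : R := \sum_(i <- s) cmod (F i n - F i m) ^+ 2.
have D0 n m : 0 <= D n m by apply: sumr_ge0 => i _; rewrite exprn_ge0 ?cmod_ge0.
(* If [n] and [m] are not close, a single term of [D n m] is already at least [d ^+ 2]. *)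
pose b := d ^+ 2; have b0 : 0 < b by rewrite exprn_gt0.
have far n m : ~~ near_at F s d n m -> b <= D n m.
  rewrite /D; elim: {h D D0} s => [//|i s ih]; rewrite big_cons /= negb_and -leNgt.
  have s0 : 0 <= \sum_(i <- s) cmod (F i n - F i m) ^+ 2.
    by apply: sumr_ge0 => j _; rewrite exprn_ge0 ?cmod_ge0.
  case/orP => [hi|/ih].
    by rewrite (le_trans (y := cmod (F i n - F i m) ^+ 2)) ?lerDl// lerXn2r ?nnegrE ?cmod_ge0 ?(ltW d0).
  move=> hb; rewrite (le_trans hb)// lerDr exprn_ge0 ?cmod_ge0//.
(* Since [r <= 1], [r ^+ 2 <= r]; so [size s] terms below [r ^+ 2] sum to at most [b / 2], half the
   threshold for far points. The successor keeps the divisor nonzero when [s] is empty. *)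
pose r := Num.min 1 (b / 2 / (size s).+1%:R).
have r0 : 0 < r by rewrite lt_min ltr01 !divr_gt0.
have close n m : near_at F s r n m -> D n m <= b / 2.
  have r2 : r ^+ 2 <= b / 2 / (size s).+1%:R.
    apply: (@le_trans _ _ r); last by rewrite ge_min lexx orbT.
    by rewrite expr2 ger_pMl// ge_min lexx.
  move=> nm; apply: (@le_trans _ _ ((size s)%:R * r ^+ 2)).
    rewrite /D; elim: (s) nm => [_|i s' ih]; first by rewrite big_nil mul0r.
    rewrite /near_at/= => /andP[hi /ih hs].
    rewrite big_cons -natr1 mulrDl mul1r addrC lerD//.
    by rewrite lerXn2r ?nnegrE ?cmod_ge0 ?ltW.
  apply: le_trans (ler_wpM2l _ r2) _ => //.
  rewrite mulrCA ger_pMr ?divr_gt0// ler_pdivrMr// mul1r ler_nat//.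
have [t ht] := near_at_net s r0.
(* [D n m <= M] keeps the bases [1 - D n m / M] nonnegative, and [b <= M] does the same for [beta]
   below. *)
have [M [M0 bM DM]] : exists M, [/\ 0 < M, b <= M & forall n m, D n m <= M].
  have [M [M0 hM]] : exists M, 0 <= M /\ forall n m, D n m <= M.
    rewrite /D; elim: (s) => [|i s' [M [M0 hM]]].
      by exists 0; split => // n m; rewrite big_nil.
    have [K K0 hK] := cstar_bounded hS (SF i).
    exists ((K + K) ^+ 2 + M); split; first by rewrite addr_ge0 ?exprn_ge0 ?addr_ge0 ?(ltW K0).
    move=> n m; rewrite big_cons lerD// lerXn2r ?nnegrE ?cmod_ge0 ?addr_ge0 ?(ltW K0)//.
    by rewrite (le_trans (cmodD _ _))// cmodN; have := hK n; have := hK m; lra.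
  by exists (M + b); split => [||n m]; have := hM 0%N 0%N; [lra|lra|have := hM n m; lra].
(* Bases of the weights are at least [alpha] for net points within [r] and at most [beta < alpha]
   for far points, so far weights are negligible once [(beta / alpha) ^+ N] is small. *)
pose alpha := 1 - b / 2 / M; pose beta := 1 - b / M.
have bM1 : b / M <= 1 by rewrite ler_pdivrMr// mul1r.
have bM0 : 0 < b / M by rewrite divr_gt0.
have ab : alpha = 1 - (b / M) / 2 by rewrite /alpha; ring.
have alpha0 : 0 < alpha by rewrite ab; lra.
have beta0 : 0 <= beta by rewrite /beta; lra.
have qq : 0 <= beta / alpha < 1.
  by rewrite divr_ge0 ?(ltW alpha0)//= ltr_pdivrMr// mul1r ab /beta; lra.
(* All far terms together contribute at most [2 * Mf * size t * beta ^+ N], to be compared with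
   [alpha ^+ N], a lower bound of the total weight. *)
have [N hN] := @exists_expr_small _ _ (2 * Mf * (size t)%:R) (e / 2) qq e20.
pose w n m := (1 - D n m / M) ^+ N.
have base0 n m : 0 <= 1 - D n m / M by rewrite subr_ge0 ler_pdivrMr// mul1r.
have w0 n m : 0 <= w n m by rewrite exprn_ge0.
have wfar n m : ~~ near_at F s d n m -> w n m <= beta ^+ N.
  by move=> /far nm; rewrite lerXn2r ?nnegrE// lerD2l lerN2 ler_pM2r ?invr_gt0.
have wnear n m : near_at F s r n m -> alpha ^+ N <= w n m.
  move=> /close nm; rewrite lerXn2r ?nnegrE ?(ltW alpha0)//.
  by rewrite lerD2l lerN2 ler_pM2r ?invr_gt0.
pose W n := \sum_(m <- t) w n m.
(* The net has a point within [r] of [n]; this uniform lower bound makes [W] invertible in [S]. *)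
have aW n : alpha ^+ N <= W n.
  have [m mt /wnear nm] := ht n; rewrite /W (big_rem m mt)/=.
  by rewrite (le_trans nm)// lerDl sumr_ge0.
have aN0 : 0 < alpha ^+ N by rewrite exprn_gt0.
have W0 n : 0 < W n by apply: lt_le_trans (aW n).
have Sw m : S (fun n => (w n m)%:C).
  have SD : S (fun n => (D n m)%:C).
    have := cstar_sum hS s (fun i => cstar_cmod2 hS (cstarB hS (SF i) (cstar_cst hS (F i m)))).
    by congr S; apply/funext => n; rewrite rmorph_sum.
  have := cstarX hS N (cstarB hS (cstar_cst hS 1) (cstarZ hS (M^-1)%:C SD)).
  congr S; apply/funext => n; rewrite rmorphXn rmorphB rmorphM/=.
  by rewrite [X in 1 - X]mulrC.
have SW : S (fun n => (W n)%:C).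
  by have := cstar_sum hS t Sw; congr S; apply/funext => n; rewrite rmorph_sum.
exists (fun n => (\sum_(m <- t) f m * (w n m)%:C) * (W n)^-1%:C).
  apply: (cstarM hS); last exact: cstar_inv hS SW aN0 aW.
  exact: (cstar_sum hS t (fun m => cstarZ hS (f m) (Sw m))).
move=> n.
(* The normalised weights sum to one, so [f n] is the weighted average of the constant [f n]. *)
have -> : (\sum_(m <- t) f m * (w n m)%:C) * (W n)^-1%:C - f n =
          (\sum_(m <- t) (f m - f n) * (w n m)%:C) * (W n)^-1%:C.
  have {1}-> : f n =  (\sum_(m <- t) f n * (w n m)%:C) * (W n)^-1%:C.
    rewrite -mulr_sumr -rmorph_sum -/(W n) -mulrA -rmorphM/=.
    by rewrite divff ?mulr1// gt_eqF.
  rewrite -mulrBl -sumrB; congr (_ * _); apply: eq_bigr => m _.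
  by rewrite mulrBl.
rewrite cmodM cmod_real ger0_norm ?invr_ge0 ?(ltW (W0 n))// ler_pdivrMr//.
apply: le_trans (cmod_sum _ _) _.
have step m : cmod ((f m - f n) * (w n m)%:C) <= e / 2 * w n m + 2 * Mf * beta ^+ N.
  rewrite cmodM cmod_real ger0_norm//.
  have b0' : 0 <= 2 * Mf * beta ^+ N by rewrite !mulr_ge0 ?exprn_ge0.
  have [/h nm|/wfar nm] := boolP (near_at F s d n m).
    by rewrite cmod_distC; have := ler_wpM2r (w0 n m) (ltW nm); lra.
  have : cmod (f m - f n) <= 2 * Mf.
    rewrite (le_trans (cmodD _ _))// cmodN; have := hMf n; have := hMf m.
    by rewrite !normr_le_cmod; lra.
  move=> hh; have := ler_pM (cmod_ge0 _) (w0 n m) hh nm.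
  have := mulr_ge0 (ltW e20) (w0 n m); lra.
apply: le_trans (ler_sum _ (fun m _ => step m)) _.
rewrite big_split/= -mulr_sumr -/(W n) big_const_seq count_predT iter_addr_0.
have -> : e * W n = e / 2 * W n + e / 2 * W n by field.
rewrite lerD2l -[leLHS]mulr_natr.
have -> : 2 * Mf * beta ^+ N * (size t)%:R = (2 * Mf * (size t)%:R * (beta / alpha) ^+ N) * alpha ^+ N.
  rewrite expr_div_n; field; exact: lt0r_neq0.
by apply: ler_pM => //; rewrite ?mulr_ge0 ?exprn_ge0 ?divr_ge0 ?(ltW alpha0).
Qed.

End UniformContinuity.

(** * Topologies given by complex coordinates; compactness of discs and products *)

Section Coordinates.
Variable R : realType.

(* The topology of [T] is the initial topology of the maps [p i]. *)
Definition coordinates (T : topologicalType) (I : Type) (p : I -> T -> R[i]) : Prop :=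
  forall x A, nbhs x A <->
    exists s d, 0 < d /\ forall y, near_at p s d y x -> A y.

Lemma coordinates_complex : @coordinates R[i] unit (fun=> id).
Proof.
move=> x A; split.
  move=> /nbhs_ballP[e /= e0 eA].
  (* The radius of a ball lies in [R[i]]; being positive, it is real. *)
  have eR : e = (complex.Re e)%:C by rewrite RRe_real// gtr0_real.
  exists [:: tt], (complex.Re e); split; first by rewrite -ltcR -eR.
  move=> y; rewrite /near_at/= andbT => yx; apply: eA.
  by rewrite /ball/= normr_cmod eR ltcR cmod_distC.
move=> [s [d [d0 h]]]; apply/nbhs_ballP; exists d%:C; first by rewrite /= ltcR.
move=> y; rewrite /ball/= normr_cmod ltcR cmod_distC => yx; apply: h.
by elim: s => //= i s ->; rewrite yx.
Qed.

(** Initial topologies compose: the product topology is initial for the evaluations, and [T] for the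
    maps [p i]. *)
Lemma coordinates_ptws (J I : Type) (T : topologicalType) (p : I -> T -> R[i]) :
  coordinates p ->
  @coordinates {ptws J -> T} (J * I) (fun ji f => p ji.2 (f ji.1)).
Proof.
move=> hp x A; pose q (ji : J * I) (f : {ptws J -> T}) := p ji.2 (f ji.1).
rewrite -/q; split; last first.
  move=> [s [d [d0 h]]].
  suff : nbhs x [set y | near_at q s d y x] by apply: filterS.
  elim: s {h} => [|[j i] s ih]; first by apply: filterE.
  have hj : nbhs x [set y | cmod (p i (y j) - p i (x j)) < d].
    have cj : {for x, continuous (fun f : {ptws J -> T} => f j)}.
      exact: (@proj_continuous {classic J} (fun=> T) j x).
    apply: (cj [set t | cmod (p i t - p i (x j)) < d]); apply/hp; exists [:: i], d; split => // y.
    by rewrite /near_at/= andbT.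
  by apply: filterS2 hj ih => y /= -> ->.
(* [G] is the filter generated by the basic boxes at [x]. It converges to [x] because it does so at
   each index [j], and hence contains every neighbourhood of [x]. *)
move: A; pose G : set_system {ptws J -> T} :=
  [set A | exists s d, 0 < d /\ forall y, near_at q s d y x -> A y].
have FG : Filter G.
  split.
  - by exists [::], 1; split.
  - move=> P Q [s1 [d1 [d10 h1]]] [s2 [d2 [d20 h2]]].
    exists (s1 ++ s2), (Num.min d1 d2); split; first by rewrite lt_min d10.
    by move=> y hy; have [/h1 ? /h2 ?] := near_at_cat hy.
  - by move=> P Q PQ [s [d [d0 h]]]; exists s, d; split => // y /h /PQ.
suff Gx : G --> x by move=> A xA; exact: (Gx A xA).
apply/cvg_sup => j; apply/cvg_image.
  by rewrite eqEsubset; split => y //= _; exists (fun=> y).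
move=> B /hp[s [d [d0 h]]].
exists [set f : {ptws J -> T} | B (f j)].
  exists [seq (j, i) | i <- s], d; split => // y hy; apply: h.
  by move: hy; rewrite /near_at all_map.
by rewrite eqEsubset; split => [_ [f /= Bf <-]//|y By]; exists (fun=> y).
Qed.

Lemma coordinates_hausdorff (T : topologicalType) (I : Type) (p : I -> T -> R[i]) :
  coordinates p -> (forall x y, (forall i, p i x = p i y) -> x = y) ->
  hausdorff_space T.
Proof.
move=> hp sep x y xy; apply: sep => i; apply/eqP; rewrite -subr_eq0 -cmod_eq0.
rewrite eq_le cmod_ge0 andbT; apply/ler_addgt0Pr => e e0; rewrite add0r.
have nb w : nbhs w [set v | cmod (p i v - p i w) < e / 2].
  apply/hp; exists [:: i], (e / 2); split; first by rewrite divr_gt0.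
  by move=> v; rewrite /near_at/= andbT.
have [v [/= vx vy]] := xy _ _ (nb x) (nb y).
by have := cmod_dist (p i x) (p i v) (p i y); rewrite cmod_distC in vx; lra.
Qed.

Lemma cmod_eq_small (a b : R[i]) : (forall e, 0 < e -> cmod (a - b) < e) -> a = b.
Proof.
move=> h; apply/eqP; rewrite -subr_eq0 -cmod_eq0 eq_le cmod_ge0 andbT.
by apply/ler_addgt0Pr => e /h; rewrite add0r => /ltW.
Qed.

Lemma compact_closure_range (T : topologicalType) (z : nat -> T) (B : set T) :
  hausdorff_space T -> compact B -> (forall n, B (z n)) -> compact (closure (range z)).
Proof.
move=> hT cB zB; apply: (subclosed_compact _ cB); first exact: closed_closure.
rewrite [B](_ : _ = closure B); last by apply/closure_id; exact: compact_closed.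
by apply: closure_subset => _ [n _ <-].
Qed.

(** The disc is a closed subset of the continuous image of the compact square with sides from [-M]
    to [M]. *)
Lemma compact_disc (M : R) : compact [set x : R[i] | cmod x <= M].
Proof.
pose g (u : R * R) : R[i] := (u.1 +i* u.2)%C.
have cg : continuous g.
  move=> u A /coordinates_complex[s [d [d0 h]]].
  apply/nbhs_ballP; exists (d / 2); first by rewrite /= divr_gt0.
  move=> v [/= h1 h2]; apply: h.
  suff hd : cmod (g v - g u) < d by elim: s => //= i s ->; rewrite hd.
  apply: le_lt_trans (cmod_le_ReIm _) _.
  move: h1 h2; rewrite /ball/= => h1 h2.
  by rewrite -[ltLHS]/(`|v.1 - u.1| + `|v.2 - u.2|) distrC [`|v.2 - u.2|]distrC; lra.
have cK : compact (g @` (`[- M, M] `*` `[- M, M])).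
  apply: continuous_compact; first exact: continuous_subspaceT.
  by apply: compact_setX; exact: segment_compact.
apply: (subclosed_compact _ cK); last first.
  move=> [a b] /= ab; exists (a, b) => //; split; rewrite /= in_itv/= -ler_norml.
    exact: le_trans (cmod_Re (a +i* b)%C) ab.
  exact: le_trans (cmod_Im (a +i* b)%C) ab.
move=> x clx; apply/ler_addgt0Pr => e e0 /=.
have [|y [/= yM yx]] := clx [set y | cmod (y - x) < e].
  by apply/coordinates_complex; exists [:: tt], e; split => // y; rewrite /near_at/= andbT.
by have := cmod_dist x y 0; rewrite !subr0 cmod_distC; lra.
Qed.

Lemma compact_ptws (J : Type) (T : topologicalType) (A : J -> set T) :
  (forall j, compact (A j)) -> compact [set f : {ptws J -> T} | forall j, A j (f j)].
Proof. exact: (@tychonoff {classic J} (fun=> T)). Qed.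

End Coordinates.

(** * Continuous functions on the closure of a sequence *)

Section DenseSequence.
Variables (R : realType) (T : topologicalType) (I : Type) (p : I -> T -> R[i]).
Hypothesis hp : coordinates p.
Variable z : nat -> T.
Let K := closure (range z).
Let F i n := p i (z n).

Lemma closure_rangeP x : K x <->
  forall s d, 0 < d -> exists n, near_at p s d (z n) x.
Proof.
split.
  move=> Kx s d d0; have [|_ [[n _ <-] /= h]] := Kx [set y | near_at p s d y x].
    by apply/hp; exists s, d.
  by exists n.
move=> h A /hp[s [d [d0 hA]]]; have [n hn] := h s d d0.
by exists (z n); split; [exists n|exact: hA].
Qed.

Lemma within_closureP (U : topologicalType) (J : Type) (q : J -> U -> R[i]) (g : T -> U) :
  coordinates q ->
  {within K, continuous g} <-> forall j x, K x -> forall e, 0 < e ->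
    exists s d, 0 < d /\ forall y, K y -> near_at p s d y x -> cmod (q j (g y) - q j (g x)) < e.
Proof.
move=> hq; split.
  move=> /subspace_continuousP gc j x Kx e e0.
  have : within K (nbhs x) [set y | cmod (q j (g y) - q j (g x)) < e].
    apply: (gc x Kx [set t | cmod (q j t - q j (g x)) < e]); apply/hq; exists [:: j], e; split => // y.
    by rewrite /near_at/= andbT.
  by move=> /hp[s [d [d0 h]]]; exists s, d; split => // y Ky /h; exact.
move=> h; apply/subspace_continuousP => x Kx A /hq[s [d [d0 hA]]].
suff : within K (nbhs x) [set y | near_at q s d (g y) (g x)].
  by apply: filterS => y /hA.
elim: s {hA} => [|j s ih]; first by apply: filterE.
have hj : within K (nbhs x) [set y | cmod (q j (g y) - q j (g x)) < d].
  have [s' [d' [d'0 h']]] := h j x Kx d d0.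
  by apply/hp; exists s', d'; split => // y /h' + Ky; apply.
by apply: filterS2 hj ih => y /= -> ->.
Qed.

Lemma within_closure_complexP (g : T -> R[i]) :
  {within K, continuous g} <-> forall x, K x -> forall e, 0 < e ->
    exists s d, 0 < d /\ forall y, K y -> near_at p s d y x -> cmod (g y - g x) < e.
Proof.
have h := within_closureP g (@coordinates_complex R).
by split => [/h/(_ tt)|hg]; [|apply/h => _].
Qed.

(** Both functions are compared at one [z n] so close to [x] that each varies by less than [e / 2].
    This gives injectivity in (i) and (ii). *)
Lemma within_closure_unique (g1 g2 : T -> R[i]) :
  {within K, continuous g1} -> {within K, continuous g2} ->
  (forall n, g1 (z n) = g2 (z n)) -> forall x, K x -> g1 x = g2 x.
Proof.
move=> /within_closure_complexP c1 /within_closure_complexP c2 g12 x Kx.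
apply: cmod_eq_small => e e0; have e20 : 0 < e / 2 by rewrite divr_gt0.
have [s1 [d1 [d10 h1]]] := c1 x Kx _ e20; have [s2 [d2 [d20 h2]]] := c2 x Kx _ e20.
have [|n nx] := (closure_rangeP x).1 Kx (s1 ++ s2) (Num.min d1 d2).
  by rewrite lt_min d10.
have [n1 n2] := near_at_cat nx.
have Kz : K (z n) by apply: subset_closure; exists n.
have := h1 _ Kz n1; have := h2 _ Kz n2; rewrite g12 => b2; rewrite cmod_distC => b1.
by have := cmod_dist (g1 x) (g2 (z n)) (g2 x); lra.
Qed.

(** The Heine-Cantor theorem, proved with the near-covering form of compactness. *)
Lemma within_closure_ucont (g : T -> R[i]) : compact K ->
  {within K, continuous g} -> ucont F (fun n => g (z n)).
Proof.
move=> /compact_near_coveringP cK /within_closure_complexP gc e e0.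
have e20 : 0 < e / 2 by rewrite divr_gt0.
pose G : set_system (nat * nat) := [set A | exists s d, 0 < d /\
  forall n m, near_at F s d n m -> A (n, m)].
have FG : Filter G.
  split.
  - by exists [::], 1; split.
  - move=> P Q [s1 [d1 [d10 h1]]] [s2 [d2 [d20 h2]]].
    exists (s1 ++ s2), (Num.min d1 d2); split; first by rewrite lt_min d10.
    by move=> n m nm; have [/h1 ? /h2 ?] := near_at_cat nm.
  - by move=> P Q PQ [s [d [d0 h]]]; exists s, d; split => // n m /h /PQ.
(* The parameter is a pair of indices, filtered by the entourages; the premise [x = z u.1] ties the
   covering point to the first index. *)
have := cK (nat * nat)%type G (fun u x => x = z u.1 -> cmod (g (z u.1) - g (z u.2)) < e) FG.
case=> [x Kx|s [d [d0 h]]]; last first.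
  exists s, d; split => // n m /h/(_ (z n)); apply => //.
  by apply: subset_closure; exists n.
have [s [d [d0 h]]] := gc x Kx _ e20; have d20 : 0 < d / 2 by rewrite divr_gt0.
exists ([set y | near_at p s (d / 2) y x], [set u | near_at F s (d / 2) u.1 u.2]).
  by split; [apply/hp|]; exists s, (d / 2).
move=> [y [n m]] [/= h1 h2] yz; rewrite {}yz in h1.
have Kz k : K (z k) by apply: subset_closure; exists k.
have h3 : near_at p s d (z n) x by apply: near_at_lt h1; lra.
have h4 : near_at p s d (z m) x.
  by apply: near_at_half h1; rewrite near_at_sym.
have b1 := h _ (Kz n) h3; have := h _ (Kz m) h4; rewrite cmod_distC => b2.
by have := cmod_dist (g (z n)) (g x) (g (z m)); lra.
Qed.

(** Extension by limits: as [z n] tends to a point of [K], the values [f n] satisfy a Cauchy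
    condition and stay in a compact disc. *)
Lemma ucont_extends (f : nat -> R[i]) : (forall i, bounded_seq (F i)) -> ucont F f ->
  exists g : T -> R[i], {within K, continuous g} /\ f = (fun n => g (z n)).
Proof.
move=> bF uf; have [M hM] := ucont_bounded bF uf.
pose L x := [set c | forall e, 0 < e -> exists s d, 0 < d /\
  forall n, near_at p s d (z n) x -> cmod (f n - c) < e].
have near_at_pair s d n m x : near_at p s (d / 2) (z n) x ->
    near_at p s (d / 2) (z m) x -> near_at F s d n m.
  by move=> h1; rewrite near_at_sym; exact: near_at_half h1.
have L0 x : K x -> exists c, L x c.
  (* [G] is the filter of values [f n] as [z n] tends to [x], proper because [x] is in the closure.
     It clusters in the disc, and uniform continuity turns the cluster point into a limit. *)
  move=> Kx; pose G : set_system R[i] := [set B | exists s d, 0 < d /\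
    forall n, near_at p s d (z n) x -> B (f n)].
  have FG : ProperFilter G.
    split; first by move=> [s [d [d0 h]]]; have [n /h] := (closure_rangeP x).1 Kx s d d0.
    split.
    - by exists [::], 1; split.
    - move=> P Q [s1 [d1 [d10 h1]]] [s2 [d2 [d20 h2]]].
      exists (s1 ++ s2), (Num.min d1 d2); split; first by rewrite lt_min d10.
      by move=> n nx; have [/h1 ? /h2 ?] := near_at_cat nx.
    - by move=> P Q PQ [s [d [d0 h]]]; exists s, d; split => // n /h /PQ.
  have [|c [_ clc]] := @compact_disc R M G FG.
    by exists [::], 1; split => // n _; rewrite /= -normr_le_cmod.
  exists c => e e0; have e20 : 0 < e / 2 by rewrite divr_gt0.
  have [s [d [d0 h]]] := uf _ e20.
  exists s, (d / 2); split; first by rewrite divr_gt0.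
  move=> n hn; have [||_ [[m hm <-] hc]] :=
      clc [set f m | m in [set m | near_at p s (d / 2) (z m) x]] [set y | cmod (y - c) < e / 2].
  - by exists s, (d / 2); split; [rewrite divr_gt0|move=> m hm; exists m].
  - by apply/coordinates_complex; exists [:: tt], (e / 2); split => // y; rewrite /near_at/= andbT.
  have := h n m (near_at_pair _ _ _ _ _ hn hm); have := cmod_dist (f n) (f m) c.
  by move: hc => /=; lra.
(* Only values on [K] matter, where [L x] is nonempty. *)
pose g x := xget 0 (L x).
have Lg x : K x -> L x (g x) by move=> /L0[c hc]; rewrite /g; case: xgetP => [_ _ //|/(_ c)].
exists g; split; last first.
  apply/funext => n; apply: cmod_eq_small => e e0.
  have [|s [d [d0]]] := @Lg (z n) _ e e0; first by apply: subset_closure; exists n.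
  by apply; exact: near_at_refl.
apply/within_closure_complexP => x Kx e e0; have e30 : 0 < e / 3 by rewrite divr_gt0.
have [s [d [d0 h]]] := Lg x Kx _ e30.
exists s, (d / 2); split; first by rewrite divr_gt0.
move=> y Ky yx; have [s' [d' [d'0 h']]] := Lg y Ky _ e30.
have [|n nx] := (closure_rangeP y).1 Ky (s ++ s') (Num.min (d / 2) d').
  by rewrite lt_min d'0 divr_gt0.
have [n1 n2] := near_at_cat nx.
have := h n (near_at_half n1 yx); have := h' n n2; rewrite cmod_distC.
by have := cmod_dist (g y) (f n) (g x); lra.
Qed.

End DenseSequence.

(** * Invariance of topological entropy under conjugacy *)

Section Conjugacy.

Lemma Ncov_eq (T T' : topologicalType) (I : eqType) (K : set T) (K' : set T')
    (V : I -> set T) (V' : I -> set T') :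
  (forall s : seq I, K `<=` \bigcup_(i in [set` s]) V i <->
                     K' `<=` \bigcup_(i in [set` s]) V' i) ->
  Ncov K V = Ncov K' V'.
Proof.
move=> h; rewrite /Ncov; case: pselect => [e|ne]; case: pselect => [e'|ne'] //.
- case: ex_minnP => m /asboolP[s [ms /h sm]] mmin.
  case: ex_minnP => m' /asboolP[s' [ms' /h sm']] mmin'.
  apply/eqP; rewrite eqn_leq; apply/andP; split.
    by apply: mmin; apply/asboolP; exists s'.
  by apply: mmin'; apply/asboolP; exists s.
- by exfalso; apply: ne'; have [n [s [ns /h sn]]] := e; exists n, s.
- by exfalso; apply: ne; have [n [s [ns /h sn]]] := e'; exists n, s.
Qed.

(** Each finite open cover of [K] is pulled back along [g'] to one of [K'] with the same covering
    numbers for all joins, so the supremum over covers of [K'] is at least as large. *)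
Lemma top_entropy_conj_le (R : realType) (T T' : topologicalType)
    (K : set T) (K' : set T') (Tm : T -> T) (Tm' : T' -> T')
    (g : T -> T') (g' : T' -> T) :
  {within K', continuous g'} ->
  (forall x, K x -> K' (g x)) -> (forall y, K' y -> K (g' y)) ->
  (forall x, K x -> g' (g x) = x) -> (forall y, K' y -> g (g' y) = y) ->
  (forall x, K x -> K (Tm x)) -> (forall x, K x -> g (Tm x) = Tm' (g x)) ->
  (top_entropy R K Tm <= top_entropy R K' Tm')%E.
Proof.
move=> cg' Kg Kg' gK g'K KT conj.
apply: ge_ereal_sup => _ [[m U] /= [oU KU] <-].
(* Continuity of [g'] on [K'] only makes the preimage relatively open; [V] is an open set with the
   same trace. *)
have hV i : exists V : set T', open V /\ V `&` K' = g' @^-1` U i `&` K'.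
  by move/continuousP: cg' => /(_ _ (oU i))/open_subspaceP[V oV VU]; exists V.
have [V hV'] := choice hV.
have VU i y : K' y -> V i y <-> U i (g' y).
  move=> Ky; have [_ e] := hV' i.
  have -> : V i y <-> (V i `&` K') y by split => // -[].
  by rewrite e; split => // -[].
apply: ereal_sup_ge; exists (entropy_cover R K Tm U) => //.
exists (existT _ m V); first split => /=.
- by move=> i; have [] := hV' i.
- move=> y Ky; have [i _ Ui] := KU _ (Kg' _ Ky).
  by exists i => //; apply/VU.
have itK j x : K x -> K (iter j Tm x).
  by move=> Kx; elim: j => //= j; exact: KT.
have itg j x : K x -> g (iter j Tm x) = iter j Tm' (g x).
  by move=> Kx; elim: j => //= j <-; rewrite conj//; exact: itK.
have jc n w x : K x -> join_cover K Tm U (n := n) w x <-> join_cover K' Tm' V w (g x).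
  move=> Kx; have gi i : V (w i) (iter i Tm' (g x)) <-> U (w i) (iter i Tm x).
    by rewrite -itg// -{2}(gK (iter i Tm x)) ?VU//; [exact/Kg/itK|exact: itK].
  by split => -[_ h]; split => [|i]; [exact: Kg|apply/gi| |apply/gi].
rewrite /entropy_cover/=; congr limn_esup; apply/funext => n.
congr ((ln _%:R / _)%:E); apply: Ncov_eq => s; split => h.
  move=> x Kx; have [w ws hw] := h _ (Kg _ Kx).
  by exists w => //; apply/jc.
move=> y Ky; have [w ws hw] := h _ (Kg' _ Ky).
by exists w => //; move: hw => /jc; rewrite g'K//; apply; exact: Kg'.
Qed.

Lemma top_entropy_conj (R : realType) (T T' : topologicalType)
    (K : set T) (K' : set T') (Tm : T -> T) (Tm' : T' -> T')
    (g : T -> T') (g' : T' -> T) :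
  {within K, continuous g} -> {within K', continuous g'} ->
  (forall x, K x -> K' (g x)) -> (forall y, K' y -> K (g' y)) ->
  (forall x, K x -> g' (g x) = x) -> (forall y, K' y -> g (g' y) = y) ->
  (forall x, K x -> K (Tm x)) -> (forall x, K x -> g (Tm x) = Tm' (g x)) ->
  top_entropy R K Tm = top_entropy R K' Tm'.
Proof.
move=> cg cg' Kg Kg' gK g'K KT conj; apply/eqP; rewrite eq_le; apply/andP; split.
  exact: (@top_entropy_conj_le R _ _ K K' Tm Tm' g g').
(* With [y] written as [g (g' y)], invariance of [K'] and equivariance of [g'] follow from those of
   [K] and [g]. *)
apply: (@top_entropy_conj_le R _ _ K' K Tm' Tm g' g) => // y Ky.
  by rewrite -(g'K y Ky) -conj; [apply/Kg/KT/Kg'|exact: Kg'].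
by rewrite -{1}(g'K y Ky) -conj ?gK//; [apply/KT/Kg'|exact: Kg'].
Qed.

End Conjugacy.

(** * Continuity of sums, products and maps described in coordinates *)

Lemma within_continuousD (R : realType) (T : topologicalType) (K : set T) (g h : T -> R[i]) :
  {within K, continuous g} -> {within K, continuous h} ->
  {within K, continuous (fun x => g x + h x)}.
Proof. by move=> cg ch x; exact: (@cvgD _ (R[i])^o _ _ _ g h _ _ (cg x) (ch x)). Qed.

Lemma within_continuousM (R : realType) (T : topologicalType) (K : set T) (g h : T -> R[i]) :
  {within K, continuous g} -> {within K, continuous h} ->
  {within K, continuous (fun x => g x * h x)}.
Proof. by move=> cg ch x; exact: (@cvgM R[i] _ _ _ g h _ _ (cg x) (ch x)). Qed.

Lemma within_continuous_cst (T U : topologicalType) (K : set T) (a : U) :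
  {within K, continuous (fun=> a)}.
Proof. by move=> x; exact: cvg_cst. Qed.

Lemma continuous_coordinates (R : realType) (T U : topologicalType) (I J : Type)
    (p : I -> T -> R[i]) (q : J -> U -> R[i]) (i : J -> I) (g : T -> U) :
  coordinates p -> coordinates q -> (forall j x, q j (g x) = p (i j) x) ->
  continuous g.
Proof.
move=> hp hq qg x A /hq[s [d [d0 h]]]; apply/hp.
exists (map i s), d; split => // y; rewrite /near_at all_map => yx; apply: h.
by apply: sub_all yx => j /=; rewrite !qg.
Qed.

(** * The algebras [A0 F] and [AF F] and the characters of [AF F] *)

Section Anqie.
Variables (R : realType) (Lambda : Type) (F : Lambda -> nat -> R[i]).
Hypothesis hF : forall l, bounded_seq (F l).

(** The index types have the shape that [coordinates_ptws] produces from [coordinates_complex],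
    hence the factors [unit]. *)
Let pX (i : Lambda * unit) (f : {ptws Lambda -> R[i]}) : R[i] := f i.1.
Let pY (i : nat * (Lambda * unit)) (w : {ptws nat -> {ptws Lambda -> R[i]}}) : R[i] :=
  w i.1 i.2.1.
Let pA (i : (nat -> R[i]) * unit) (x : {ptws (nat -> R[i]) -> R[i]}) : R[i] := x i.1.

(** Up to re-indexing, [F0] is the family [F] and [G0] consists of the translates
    [n |-> F l (n + k)]. *)
Let F0 i n := pX i (zF F n).
Let G0 i n := pY i (kappaF F n).

Let hpX : coordinates pX.
Proof. exact: (coordinates_ptws (@coordinates_complex R)). Qed.

Let hpY : coordinates pY.
Proof. exact: (coordinates_ptws hpX). Qed.

Let hpA : coordinates pA.
Proof. exact: (coordinates_ptws (@coordinates_complex R)). Qed.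

Let bounded_F0 i : bounded_seq (F0 i).
Proof. exact: hF. Qed.

Let bounded_G0 i : bounded_seq (G0 i).
Proof. by have [M hM] := hF i.2.1; exists M => n; exact: hM. Qed.

Lemma A0E : A0 F = ucont F0.
Proof.
apply/seteqP; split=> f.
  by apply; [exact: ucont_cstar_subalg|move=> l; exact: (ucont_gen F0 (l, tt))].
by move=> uf S hS SF; apply: ucont_sub_cstar uf => // -[l []]; exact: SF.
Qed.

(** The shift sends the translate by [k] to the translate by [k + 1], so raising the time indices of
    the entourage suffices. *)
Lemma ucont_sigma f : ucont G0 f -> ucont G0 (sigmaA f).
Proof.
move=> uf e /uf[s [d [d0 h]]].
exists [seq (i.1.+1, i.2) | i <- s], d; split => // n m.
rewrite /near_at all_map => nm; apply: h; apply: sub_all nm => -[k l] /=.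
by rewrite /G0 /pY /kappaF /= !addnS !addSn.
Qed.

Lemma AFE : AF F = ucont G0.
Proof.
apply/seteqP; split=> f.
  apply; [exact: ucont_cstar_subalg|exact: ucont_sigma|].
  rewrite A0E => g ug; apply: ucont_sub_cstar ug => //; first exact: ucont_cstar_subalg.
  move=> [l []]; have := ucont_gen G0 (0%N, (l, tt)).
  by congr ucont; apply/funext => n; rewrite /G0 /pY /kappaF /= addn0.
move=> uf S hS hs A0S; apply: ucont_sub_cstar uf => // -[k [l []]].
(* Invariance under [sigmaA] supplies the translates one at a time, starting from [F l] itself. *)
elim: k => [|k ih]; last first.
  by have := hs _ ih; congr S; apply/funext => n; rewrite /sigmaA /G0 /pY /kappaF /= addSnnS.
suff : S (F l) by congr S; apply/funext => n; rewrite /G0 /pY /kappaF /= addn0.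
by apply: A0S => S' _; apply.
Qed.

Lemma AF_cstar_subalg : is_cstar_subalg (AF F).
Proof. by rewrite AFE; exact: ucont_cstar_subalg. Qed.

Lemma AF_sigma : sigma_invariant (AF F).
Proof. by rewrite AFE; exact: ucont_sigma. Qed.

Lemma AF_gen i : AF F (G0 i).
Proof. by rewrite AFE; exact: ucont_gen. Qed.

Let box M : set {ptws Lambda -> R[i]} := [set f | forall l, cmod (f l) <= M l].

Let compact_box M : compact (box M).
Proof. exact: (compact_ptws (fun l => @compact_disc R (M l))). Qed.

Let F_bound : exists M : Lambda -> R, forall n, box M (zF F n).
Proof.
have [M hM] := choice hF; exists M => n l.
by rewrite -normr_le_cmod; exact: hM.
Qed.

(** A closed subset of a product of discs, compact by Tychonoff's theorem; the product is Hausdorff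
    since its coordinates separate points. *)
Lemma compact_X0 : compact (X0 F).
Proof.
have [M hM] := F_bound; apply: (compact_closure_range _ (compact_box (M := M))) => //.
by apply: (coordinates_hausdorff hpX) => x y h; apply/funext => l; exact: (h (l, tt)).
Qed.

Lemma compact_YF : compact (YF F).
Proof.
have [M hM] := F_bound.
apply: (compact_closure_range _ (compact_ptws (fun _ : nat => compact_box (M := M)))).
  apply: (coordinates_hausdorff hpY) => x y h; apply/funext => k; apply/funext => l.
  exact: (h (k, (l, tt))).
by move=> n k; exact: hM.
Qed.

Lemma A0_continuous (g : {ptws Lambda -> R[i]} -> R[i]) : {within X0 F, continuous g} ->
  A0 F (fun n => g (zF F n)).
Proof. by rewrite A0E => /(within_closure_ucont hpX compact_X0). Qed.

Lemma A0_extends f : A0 F f -> exists g : {ptws Lambda -> R[i]} -> R[i],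
  {within X0 F, continuous g} /\ f = (fun n => g (zF F n)).
Proof. by rewrite A0E => /(ucont_extends hpX bounded_F0). Qed.

Lemma AF_continuous (h : {ptws nat -> {ptws Lambda -> R[i]}} -> R[i]) :
  {within YF F, continuous h} -> AF F (fun n => h (kappaF F n)).
Proof. by rewrite AFE => /(within_closure_ucont hpY compact_YF). Qed.

Lemma AF_extends f : AF F f -> exists h : {ptws nat -> {ptws Lambda -> R[i]}} -> R[i],
  {within YF F, continuous h} /\ f = (fun n => h (kappaF F n)).
Proof. by rewrite AFE => /(ucont_extends hpY bounded_G0). Qed.

(* Restates [XF] for [x] of plain function type, where the ring operations
   on the values of [x] are found by unification. *)
Lemma XF_char (x : (nat -> R[i]) -> R[i]) : XF F x ->
  [/\ (forall f, ~ AF F f -> x f = 0),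
     x (fun=> 1) = 1,
     (forall f g, AF F f -> AF F g -> x (fun n => f n + g n) = x f + x g),
     (forall (a : R[i]) f, AF F f -> x (fun n => a * f n) = a * x f) &
     (forall f g, AF F f -> AF F g -> x (fun n => f n * g n) = x f * x g)].
Proof. by []. Qed.

(* Otherwise [\sum_(f <- s) |f - x f|^2] would be invertible in [AF F],
   although the character [x] annihilates it. *)
Lemma XF_dense (x : (nat -> R[i]) -> R[i]) (s : seq (nat -> R[i])) (d : R) : XF F x -> 0 < d ->
  (forall f, List.In f s -> AF F f) ->
  exists n, all (fun f => cmod (f n - x f) < d) s.
Proof.
move=> /XF_char[_ x1 xD xZ xM] d0 sA; apply: contrapT => /forallNP hn.
have hS := AF_cstar_subalg.
pose a (s : seq (nat -> R[i])) n := \sum_(f <- s) cmod (f n - x f) ^+ 2.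
have xcst c : x (fun=> c) = c.
  have := xZ c _ (cstar_cst hS 1); rewrite x1 mulr1 => h.
  by rewrite -[RHS]h; congr x; apply/funext => n; rewrite mulr1.
have term f : AF F f -> AF F (fun n => (cmod (f n - x f) ^+ 2)%:C) /\
    x (fun n => (cmod (f n - x f) ^+ 2)%:C) = 0.
  move=> Af; have Af0 : AF F (fun n => f n - x f) by exact: (cstarB hS Af (cstar_cst hS (x f))).
  split; first exact: (cstar_cmod2 hS Af0).
  have -> : (fun n => (cmod (f n - x f) ^+ 2)%:C) =
            (fun n => (f n - x f) * Num.conj (f n - x f)).
    by apply/funext => n; rewrite mulr_conj.
  rewrite (xM _ _ Af0 (cstarJ hS Af0)).
  by rewrite (xD f (fun=> - x f) Af (cstar_cst hS _)) xcst subrr mul0r.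
have [Aa xa] : AF F (fun n => (a s n)%:C) /\ x (fun n => (a s n)%:C) = 0.
  elim: s sA {hn} => [_|f s ih sA].
    have -> : (fun n => (a [::] n)%:C) = fun=> 0.
      by apply/funext => n; rewrite /a big_nil.
    by split; [exact: (cstar_cst hS)|rewrite xcst].
  have [Af xf] := term f (sA f (or_introl erefl)).
  have [As xs] := ih (fun g sg => sA g (or_intror sg)).
  have -> : (fun n => (a (f :: s) n)%:C) =
            (fun n => (cmod (f n - x f) ^+ 2)%:C + (a s n)%:C).
    by apply/funext => n; rewrite /a big_cons rmorphD.
  by split; [exact: (cstarD hS Af As)|rewrite (xD _ _ Af As) xf xs addr0].
(* By assumption every [n] fails for some [f] in [s], whose summand alone is at least [d ^+ 2]. *)
have a_ge n : d ^+ 2 <= a s n.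
  have := hn n; rewrite /a; elim: (s) => //= f s' ih /negP.
  rewrite negb_and -leNgt big_cons.
  have s0 : 0 <= \sum_(f <- s') cmod (f n - x f) ^+ 2.
    by apply: sumr_ge0 => g _; rewrite exprn_ge0 ?cmod_ge0.
  have f0 : 0 <= cmod (f n - x f) ^+ 2 by rewrite exprn_ge0 ?cmod_ge0.
  case/orP => [df|/negP/ih hs]; last by rewrite (le_trans hs)// lerDr.
  have : d ^+ 2 <= cmod (f n - x f) ^+ 2 by rewrite lerXn2r ?nnegrE ?cmod_ge0 ?(ltW d0).
  by lra.
have Ab := cstar_inv hS Aa (exprn_gt0 2 d0) a_ge.
have := xM _ _ Aa Ab; rewrite xa mul0r.
rewrite (_ : (fun n => _) = fun=> 1) ?x1; first by apply/eqP; rewrite oner_eq0.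
apply/funext => n; rewrite -rmorphM/= divff//.
by rewrite gt_eqF// (lt_le_trans _ (a_ge n))// exprn_gt0.
Qed.

Definition restrict_char (x : {ptws (nat -> R[i]) -> R[i]}) :
  {ptws nat -> {ptws Lambda -> R[i]}} := fun k l => x (fun n => F l (n + k)%N).

(** Density of evaluations, applied to finitely many generators [G0 i], puts some [kappaF F n] in
    each basic neighbourhood. *)
Lemma restrict_char_YF x : XF F x -> YF F (restrict_char x).
Proof.
move=> Xx; apply/(closure_rangeP hpY) => s d d0.
have [|n hn] := XF_dense (s := map G0 s) Xx d0.
  by move=> f /List.in_map_iff[i [<- _]]; exact: AF_gen.
by exists n; move: hn; rewrite all_map.
Qed.

Lemma continuous_restrict_char : continuous restrict_char.
Proof. exact: (@continuous_coordinates _ _ _ _ _ pA pY (fun i => (G0 i, tt))). Qed.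

(** A simultaneous choice of continuous extensions; the zero function off [AF F] matches the
    convention for [XF F]. *)
Lemma extension_exists : exists H : (nat -> R[i]) -> {ptws nat -> {ptws Lambda -> R[i]}} -> R[i],
  (forall f, ~ AF F f -> H f = fun=> 0) /\
  (forall f, AF F f -> {within YF F, continuous (H f)} /\ forall n, H f (kappaF F n) = f n).
Proof.
pose P f (h : {ptws nat -> {ptws Lambda -> R[i]}} -> R[i]) :=
  (~ AF F f -> h = fun=> 0) /\
  (AF F f -> {within YF F, continuous h} /\ forall n, h (kappaF F n) = f n).
have /choice[H HP] : forall f, exists h, P f h.
  move=> f; have [Af|nAf] := pselect (AF F f).
    by have [h [hc hf]] := AF_extends Af; exists h; split => // _; split => // n; rewrite hf.
  by exists (fun=> 0); split.
by exists H; split => f; have [] := HP f.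
Qed.

Lemma homeomorphism_XF_YF : exists
  Phi : {ptws nat -> {ptws Lambda -> R[i]}} -> {ptws (nat -> R[i]) -> R[i]},
  [/\ {within YF F, continuous Phi},
      (forall x, XF F x -> Phi (restrict_char x) = x) &
      (forall y, YF F y -> XF F (Phi y) /\ restrict_char (Phi y) = y)].
Proof.
have [H [H0 HA]] := extension_exists.
have hS := AF_cstar_subalg.
(* By density of the points [kappaF F n], any continuous extension of [f] agrees with [H f] on
   [YF F]. The character laws for [H] at [y] all come from this. *)
have ext f y (h : {ptws nat -> {ptws Lambda -> R[i]}} -> R[i]) :
    AF F f -> {within YF F, continuous h} -> (forall n, h (kappaF F n) = f n) ->
    YF F y -> H f y = h y.
  move=> /HA[cH Hf] ch hf; apply: (within_closure_unique hpY cH ch) => n.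
  by rewrite Hf hf.
exists (fun y f => H f y); split.
- apply/(within_closureP hpY (kappaF F) _ hpA) => -[f []] y Yy e e0.
  have [Af|nAf] := pselect (AF F f).
    by have [/(within_closure_complexP hpY) /(_ y Yy e e0)] := HA f Af.
  by exists [::], 1; split => // y' _ _; rewrite /pA/= H0// subrr cmod0.
- move=> x Xx; apply/funext => f; have [Af|nAf] := pselect (AF F f); last first.
    by have [x0 _ _ _ _] := Xx; rewrite x0// H0.
  have [/(within_closure_complexP hpY) cH Hf] := HA f Af.
  apply: cmod_eq_small => e e0; have e20 : 0 < e / 2 by rewrite divr_gt0.
  have [s [d [d0 h]]] := cH _ (restrict_char_YF Xx) _ e20.
  (* A single evaluation approximates [x] both at [f] and at the generators controlling [H f] near
     [restrict_char x], so [H f (restrict_char x)] and [x f] are both within [e / 2] of [f n]. *)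
  have [||n /= /andP[fn sn]] := XF_dense (s := f :: map G0 s) (d := Num.min d (e / 2)) Xx.
  + by rewrite lt_min d0.
  + by move=> g [<-//|/List.in_map_iff[i [<- _]]]; exact: AF_gen.
  have Yk : YF F (kappaF F n) by apply: subset_closure; exists n.
  have := h _ Yk; rewrite Hf => /(_ _)/= h'.
  have {}h' : cmod (f n - H f (restrict_char x)) < e / 2.
    apply: h'; move: sn; rewrite all_map; apply: sub_all => i /=.
    by rewrite lt_min => /andP[].
  move: fn; rewrite lt_min => /andP[_ fn].
  rewrite cmod_distC in h'.
  by have := cmod_dist (H f (restrict_char x)) (f n) (x f); lra.
- move=> y Yy; split; last first.
    apply/funext => k; apply/funext => l.
    (* The coordinate function itself is a continuous extension of the generator
       [G0 (k, (l, tt))]. *)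
    apply: (ext _ _ (pY (k, (l, tt)))) => //; first exact: (AF_gen (k, (l, tt))).
    apply/(within_closure_complexP hpY) => x Kx e e0.
    by exists [:: (k, (l, tt))], e; split => // y' _; rewrite /near_at/= andbT.
  split=> [f nAf||f g Af Ag|a f Af|f g Af Ag].
  + by rewrite H0.
  + apply: (ext _ _ (fun=> 1)) => //; first exact: (cstar_cst hS).
    exact: within_continuous_cst.
  + have [cf hf] := HA f Af; have [cg hg] := HA g Ag.
    have cfg := within_continuousD cf cg.
    by apply: (ext _ _ _ (cstarD hS Af Ag) cfg) => // n; rewrite hf hg.
  + have [cf hf] := HA f Af.
    have caf := within_continuousM (@within_continuous_cst _ _ (YF F) a) cf.
    by apply: (ext _ _ _ (cstarZ hS a Af) caf) => // n; rewrite hf.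
  + have [cf hf] := HA f Af; have [cg hg] := HA g Ag.
    have cfg := within_continuousM cf cg.
    by apply: (ext _ _ _ (cstarM hS Af Ag) cfg) => // n; rewrite hf hg.
Qed.

Lemma AmapF_XF x : XF F x -> XF F (AmapF F x).
Proof.
have hS := AF_cstar_subalg; have hs := AF_sigma.
have AfE y f : AF F f -> AmapF F y f = y (sigmaA f) by rewrite /AmapF => /asboolT ->.
move=> [x0 x1 xD xZ xM]; split=> [f nAf||f g Af Ag|a f Af|f g Af Ag].
- by rewrite /AmapF asboolF.
- by rewrite AfE; [exact: x1|exact: (cstar_cst hS)].
- by rewrite !AfE//; [apply: xD; exact: hs|exact: (cstarD hS Af Ag)].
- by rewrite !AfE//; [apply: xZ; exact: hs|exact: (cstarZ hS a Af)].
- by rewrite !AfE//; [apply: xM; exact: hs|exact: (cstarM hS Af Ag)].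
Qed.

Lemma restrict_char_iota n : restrict_char (iotaF F n) = kappaF F n.
Proof.
apply/funext => k; apply/funext => l.
by rewrite /restrict_char /iotaF asboolT //; exact: (AF_gen (k, (l, tt))).
Qed.

Lemma restrict_char_Amap x : restrict_char (AmapF F x) = Bshift (restrict_char x).
Proof.
apply/funext => k; apply/funext => l.
rewrite /restrict_char /AmapF /Bshift asboolT; last exact: (AF_gen (k, (l, tt))).
by congr x; apply/funext => n; rewrite /sigmaA addSnnS.
Qed.

End Anqie.
Theorem theorem3p3 (R : realType) (Lambda : Type) (F : Lambda -> nat -> R[i])
    (hF : forall l, bounded_seq (F l)) :
  (* (i) A_0 = C(X_0) via g |-> (n |-> g (z_n)) *)
  ((forall g : {ptws Lambda -> R[i]} -> R[i], {within X0 F, continuous g} ->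
       A0 F (fun n => g (zF F n))) /\
   (forall f, A0 F f -> exists g : {ptws Lambda -> R[i]} -> R[i],
       {within X0 F, continuous g} /\ f = (fun n => g (zF F n))) /\
   (forall g1 g2 : {ptws Lambda -> R[i]} -> R[i],
       {within X0 F, continuous g1} -> {within X0 F, continuous g2} ->
       (fun n => g1 (zF F n)) = (fun n => g2 (zF F n)) ->
       forall x, X0 F x -> g1 x = g2 x)) /\
  (* (ii) A_F = C(Y_F) via h |-> (n |-> h (kappa_n)) *)
  ((forall h : {ptws nat -> {ptws Lambda -> R[i]}} -> R[i],
       {within YF F, continuous h} -> AF F (fun n => h (kappaF F n))) /\
   (forall f, AF F f -> exists h : {ptws nat -> {ptws Lambda -> R[i]}} -> R[i],
       {within YF F, continuous h} /\ f = (fun n => h (kappaF F n))) /\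
   (forall h1 h2 : {ptws nat -> {ptws Lambda -> R[i]}} -> R[i],
       {within YF F, continuous h1} -> {within YF F, continuous h2} ->
       (fun n => h1 (kappaF F n)) = (fun n => h2 (kappaF F n)) ->
       forall y, YF F y -> h1 y = h2 y)) /\
  (* (iii) a homeomorphism X_F -> Y_F sending iota(n) to kappa_n and
     conjugating A to B_F; hence AE(F) = h(B_F) *)
  ((exists (Psi : {ptws (nat -> R[i]) -> R[i]} -> {ptws nat -> {ptws Lambda -> R[i]}})
           (Phi : {ptws nat -> {ptws Lambda -> R[i]}} -> {ptws (nat -> R[i]) -> R[i]}),
      [/\ {within XF F, continuous Psi} /\ {within YF F, continuous Phi},
          (forall x, XF F x -> YF F (Psi x) /\ Phi (Psi x) = x),
          (forall y, YF F y -> XF F (Phi y) /\ Psi (Phi y) = y),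
          (forall n, Psi (iotaF F n) = kappaF F n) &
          (forall x, XF F x -> Psi (AmapF F x) = Bshift (Psi x))]) /\
   AE F = top_entropy R (YF F) (@Bshift R Lambda)).
Proof.
split; [|split].
- split; [exact: A0_continuous|split; first exact: A0_extends].
  move=> g1 g2 c1 c2 g12 x X0x.
  apply: (within_closure_unique (coordinates_ptws (@coordinates_complex R)) c1 c2 _ X0x).
  by move=> n; exact: (congr1 (@^~ n) g12).
- split; [exact: AF_continuous|split; first exact: AF_extends].
  move=> h1 h2 c1 c2 h12 y Yy.
  apply: (within_closure_unique
    (coordinates_ptws (coordinates_ptws (@coordinates_complex R))) c1 c2 _ Yy).
  by move=> n; exact: (congr1 (@^~ n) h12).
have [Phi [cPhi PhiK KPhi]] := homeomorphism_XF_YF hF.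
have cPsi : {within XF F, continuous (restrict_char F)}.
  exact/continuous_subspaceT/continuous_restrict_char.
split.
  exists (restrict_char F), Phi; split => //.
  - by move=> x Xx; split; [exact: restrict_char_YF|exact: PhiK].
  - by move=> n; exact: restrict_char_iota.
  - by move=> x _; exact: restrict_char_Amap.
apply: (@top_entropy_conj _ _ _ _ _ _ _ (restrict_char F) Phi) => //.
- by move=> x Xx; exact: restrict_char_YF.
- by move=> y /KPhi[].
- by move=> y /KPhi[].
- by move=> x Xx; exact: AmapF_XF.
- by move=> x _; exact: restrict_char_Amap.
Qed.
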